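(* Let $(X,d)$ be a controlled metric type space with control function $\alpha : X\times X\to[1,\infty)$, and let $r\ge 0$ be a real number. If a sequence $\{x_n\}_{n\in\mathbb N}$ in $X$ converges to $x\in X$, and if $\sup_{u,v\in X}\alpha(u,v)$ exists (is finite) and equals $k$, then $\overline{B}(x,r)\subseteq LIM^{rk}x_n$ and $LIM^{r}x_n\subseteq \overline{B}(x,rk)$.
   Context: A controlled metric type space is a nonempty set $X$ with functions $\alpha: X\times X\to[1,\infty)$ and $d:X\times X\to[0,\infty)$ such that for all $x,y,z\in X$: $d(x,y)=0$ iff $x=y$; $d(x,y)=d(y,x)$; and $d(x,y)\le \alpha(x,z)d(x,z)+\alpha(z,y)d(z,y)$. (No symmetry of $\alpha$ is assumed.) The closed ball is $\overline{B}(x,r)=\{y\in X: d(x,y)\le r\}$. A sequence $\{x_n\}$ converges to $x$ if for every $\varepsilon>0$ there is $K\in\mathbb N$ with $d(x_n,x)<\varepsilon$ for all $n\ge K$. For a real $\rho\ge0$, a sequence $\{x_n\}$ in $X$ is $\rho$-convergent (rough convergent of roughness degree $\rho$) to $x\in X$ if for every $\varepsilon>0$ there is $n_0\in\mathbb N$ with $d(x_n,x)<\rho+\varepsilon$ for all $n\ge n_0$. The $\rho$-limit set $LIM^{\rho}x_n$ is the set of all $x\in X$ to which $\{x_n\}$ is $\rho$-convergent. *)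

(* Defs.v *)
From HB Require Import structures.
From mathcomp Require Import all_boot all_order all_algebra.
From mathcomp Require Import all_classical all_reals.

Set Implicit Arguments.
Unset Strict Implicit.
Unset Printing Implicit Defensive.

Import Order.TTheory GRing.Theory Num.Theory.
Local Open Scope classical_set_scope.
Local Open Scope ring_scope.

(* alpha is not assumed symmetric. *)
Record controlled_metric (R : realType) (X : Type)
    (alpha d : X -> X -> R) : Prop := ControlledMetric {
  cm_inhabited : inhabited X;
  cm_alpha_ge1 : forall x y, 1 <= alpha x y;
  cm_ge0 : forall x y, 0 <= d x y;
  cm_eq0 : forall x y, d x y = 0 <-> x = y;
  cm_sym : forall x y, d x y = d y x;
  cm_triangle : forall x y z,
    d x y <= alpha x z * d x z + alpha z y * d z y
}.

(* A controlled metric need not generate a pseudometric uniformity, so balls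
   and convergence are defined from d directly and not through the library's
   pseudoMetricType. *)
Definition cball (R : realType) (X : Type) (d : X -> X -> R)
    (x : X) (r : R) : set X :=
  [set y | d x y <= r].

Definition converges_to (R : realType) (X : Type) (d : X -> X -> R)
    (u : nat -> X) (x : X) : Prop :=
  forall e : R, 0 < e ->
    exists K : nat, forall n : nat, (K <= n)%N -> d (u n) x < e.

Definition rough_converges_to (R : realType) (X : Type) (d : X -> X -> R)
    (rho : R) (u : nat -> X) (x : X) : Prop :=
  forall e : R, 0 < e ->
    exists n0 : nat, forall n : nat, (n0 <= n)%N -> d (u n) x < rho + e.

Definition rough_lim_set (R : realType) (X : Type) (d : X -> X -> R)
    (rho : R) (u : nat -> X) : set X :=
  [set x | rough_converges_to d rho u x].

Definition control_values (R : realType) (X : Type)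
    (alpha : X -> X -> R) : set R :=
  range (fun p : X * X => alpha p.1 p.2).

(* Main.v *)
Require Import Defs.
From mathcomp Require Import all_boot all_order all_algebra.
From mathcomp Require Import all_classical all_reals.
From mathcomp Require Import lra.

Import Order.TTheory GRing.Theory Num.Theory.
Local Open Scope classical_set_scope.
Local Open Scope ring_scope.

(** Replacing both control factors by their supremum [k] turns the controlled triangle inequality
    into a b-metric one with constant [k] ([controlled_triangle_sup]). Passing through [x] gives the
    first inclusion, and passing through a late term of [u] gives the second; each costs one factor
    [k]. *)

Lemma control_le_sup (R : realType) (X : Type) (alpha : X -> X -> R)
    (hsup : has_sup (control_values alpha)) (x y : X) :
  alpha x y <= sup (control_values alpha).
Proof.
by apply: ub_le_sup; [case: hsup | exists (x, y)].
Qed.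

(** Positivity is what permits dividing by [k]; it comes from a diagonal value [alpha x x], at least
    1, at some point of the inhabited [X]. *)
Lemma control_sup_gt0 (R : realType) (X : Type) (alpha d : X -> X -> R)
    (hX : controlled_metric alpha d) (hsup : has_sup (control_values alpha)) :
  0 < sup (control_values alpha).
Proof.
have [x] := cm_inhabited hX.
apply: lt_le_trans (control_le_sup _ _ _ hsup x x).
exact: lt_le_trans ltr01 (cm_alpha_ge1 hX x x).
Qed.

Lemma controlled_triangle_sup (R : realType) (X : Type) (alpha d : X -> X -> R)
    (hX : controlled_metric alpha d) (hsup : has_sup (control_values alpha))
    (x y z : X) :
  d x y <= sup (control_values alpha) * (d x z + d z y).
Proof.
apply: le_trans (cm_triangle hX x y z) _; rewrite mulrDr.
by apply: lerD; apply: ler_wpM2r; rewrite ?(cm_ge0 hX) ?control_le_sup.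
Qed.

Theorem theorem3p6 (R : realType) (X : Type) (alpha d : X -> X -> R)
    (hX : controlled_metric alpha d) (r : R) (hr : 0 <= r)
    (u : nat -> X) (x : X) (hu : converges_to d u x)
    (k : R) (hsup : has_sup (control_values alpha))
    (hk : sup (control_values alpha) = k) :
  cball d x r `<=` rough_lim_set d (r * k) u /\
  rough_lim_set d r u `<=` cball d x (r * k).
Proof.
have k_gt0 : 0 < k by rewrite -hk; exact: control_sup_gt0 hX hsup.
have tri := controlled_triangle_sup _ _ _ _ hX hsup; rewrite hk in tri.
split=> y.
  rewrite /cball /= => dxy e e_gt0.
  (* The tolerance [e / k] absorbs the factor [k], leaving exactly [e] beyond [r * k]. *)
  have [K hK] := hu _ (divr_gt0 e_gt0 k_gt0).
  exists K => n /hK dun; apply: le_lt_trans (tri _ _ x) _.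
  have -> : r * k + e = k * (e / k + r).
    by rewrite mulrDr mulrCA divff ?gt_eqF // mulr1 addrC [r * k]mulrC.
  by rewrite ltr_pM2l // ltr_leD.
(* With [k] moved to the left, the slack [e] is added to [r] itself, so it splits into halves: one
   for convergence to [x], one for rough convergence to [y]. *)
move=> hy; rewrite /cball /= mulrC -ler_pdivrMl //.
apply/ler_addgt0Pr => e e_gt0.
have e2_gt0 : 0 < e / 2 by rewrite divr_gt0.
have [K hK] := hu _ e2_gt0; have [N hN] := hy _ e2_gt0.
have dun := hK _ (leq_maxl K N); have duny := hN _ (leq_maxr K N).
rewrite ler_pdivrMl //; apply: le_trans (tri _ _ (u (maxn K N))) _.
by rewrite ler_pM2l // (cm_sym hX x); lra.
Qed.
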